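(* Let $c,n,k$, $I_c$, $V_{n,\infty}^{(k)}$ and $D_{n,\infty}^{(k)}$ be as in the context. (i) If $f\in C^2(I_c)$ and $\|f''\|_\infty<\infty$, then $$\left\|V_{n,\infty}^{(k)}f-D_{n,\infty}^{(k)}f\right\|_\infty\le\frac{k}{24n^2}\,\|f''\|_\infty .$$ (ii) For an arbitrary $f\in C(I_c)$ in the domain of $V_{n,\infty}^{(k)}$, $$\left\|V_{n,\infty}^{(k)}f-D_{n,\infty}^{(k)}f\right\|_\infty\le\omega\!\left(f;\frac{k}{2n}\right).$$
   Context: Let $c,n\in\mathbb{R}$ with $n>c$ if $c\ge 0$ and $-n/c\in\mathbb{N}$ if $c<0$. Let $I_c=[0,\infty)$ if $c\ge0$ and $I_c=[0,-1/c]$ if $c<0$. Let $k\in\mathbb{N}=\{1,2,\dots\}$, with $k<-n/c$ if $c<0$. Throughout $\|g\|_\infty=\sup_{x\in I_c}|g(x)|$, and $\omega(f;\delta)=\sup\{|f(s)-f(t)|: s,t\in I_c,\ |s-t|\le\delta\}\in[0,\infty]$ is the modulus of continuity. For $m>0$ (with $-m/c\in\mathbb{N}$ if $c<0$) and $j\in\mathbb{N}_0$ the basis functions (depending on $c$) are $$p_{m,j}(x)=\frac{m^j}{j!}x^je^{-mx}\ (c=0),\qquad p_{m,j}(x)=\frac{\prod_{i=0}^{j-1}(m+ci)}{j!}\,x^j(1+cx)^{-(m/c+j)}\ (c\ne0),$$ for $x\in I_c$; if $c<0$, $p_{m,j}=0$ for $j>-m/c$, and all sums over $j$ below are then finite,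 running only over $0\le j\le -m/c$. The Baskakov-type operators are $B_{n,\infty}f(x)=\sum_{j=0}^\infty p_{n,j}(x)f(j/n)$. With $(I_kf)(x)=\int_0^x\frac{(x-t)^{k-1}}{(k-1)!}f(t)\,dt$ and $D^k$ the $k$-th derivative, their $k$-th order Kantorovich modification is $B_{n,\infty}^{(k)}=D^k\circ B_{n,\infty}\circ I_k$, and $$V_{n,\infty}^{(k)}:=\frac{n^k}{\prod_{l=0}^{k-1}(n+cl)}\,B_{n,\infty}^{(k)} .$$ The associated discrete operator is $$D_{n,\infty}^{(k)}f(x)=\sum_{j=0}^\infty f\!\left(\frac{2j+k}{2n}\right)p_{n+kc,j}(x).$$ Functions $f$ are continuous on $I_c$ and are assumed to be such that the series involved converge on $I_c$ (absolutely); in particular, ''in the domain of $V_{n,\infty}^{(k)}$'' means that the series defining $B_{n,\infty}(I_kf)$ converges absolutely on $I_c$. *)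

(* Defs.v *)
From Stdlib Require Import Reals Factorial.
From Coquelicot Require Import Coquelicot.
Local Open Scope R_scope.

Definition Ic (c x : R) : Prop := 0 <= x /\ (c < 0 -> x <= - (1 / c)).

(** Differentiation relative to a set [D]: at an endpoint of an interval the
    derivative is the one-sided one, and values outside [D] play no role.
    As with [Derive], the value of [derive_on] is meaningful only where the
    derivative exists; it is unique at every accumulation point of [D]. *)

Definition ex_derive_on (D : R -> Prop) (f : R -> R) (x : R) : Prop :=
  exists l : R, D_in f (fun _ => l) D x.

Definition derive_on (D : R -> Prop) (f : R -> R) (x : R) : R :=
  iota (fun l : R => D_in f (fun _ => l) D x).

Fixpoint derive_n_on (D : R -> Prop) (k : nat) (f : R -> R) : R -> R :=
  match k with
  | O => f
  | S k' => derive_on D (derive_n_on D k' f)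
  end.

Definition Cn_on (D : R -> Prop) (k : nat) (f : R -> R) : Prop :=
  (forall i x, (i < k)%nat -> D x -> ex_derive_on D (derive_n_on D i f) x) /\
  (forall i, (i <= k)%nat -> continuous_on D (derive_n_on D i f)).

(** Suprema are taken in [Rbar], so they may be [p_infty]. *)

Definition supnorm (D : R -> Prop) (g : R -> R) : Rbar :=
  Lub_Rbar (fun y => exists x, D x /\ y = Rabs (g x)).

Definition omega (D : R -> Prop) (f : R -> R) (delta : R) : Rbar :=
  Lub_Rbar (fun y => exists s t,
    D s /\ D t /\ Rabs (s - t) <= delta /\ y = Rabs (f s - f t)).

(** [rising c m j] is the product of [m + c i] over [0 <= i < j]. *)
Fixpoint rising (c m : R) (j : nat) : R :=
  match j with
  | O => 1
  | S j' => rising c m j' * (m + c * INR j')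
  end.

(** [Rpower 0 a] is [1] for every [a] (because [ln 0 = 0]); this corrects it to
    [0 ^ 0 = 1] and [0 ^ a = 0] for [a <> 0].  Base [0] occurs below only at the
    right endpoint [x = -1/c] when [c < 0], with exponent a natural number. *)
Definition rpow (b a : R) : R :=
  if Req_EM_T b 0 then (if Req_EM_T a 0 then 1 else 0) else Rpower b a.

(** For [c < 0] the functions with [j > -m/c] vanish, so that the series
    below reduce to finite sums over [0 <= j <= -m/c]. *)
Definition basis (c m : R) (j : nat) (x : R) : R :=
  if Req_EM_T c 0 then
    m ^ j / INR (fact j) * x ^ j * exp (- (m * x))
  else if Rlt_dec c 0 then
    if Rlt_dec (- (m / c)) (INR j) then 0
    else rising c m j / INR (fact j) * x ^ j * rpow (1 + c * x) (- (m / c + INR j))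
  else rising c m j / INR (fact j) * x ^ j * rpow (1 + c * x) (- (m / c + INR j)).

Definition B_term (c n : R) (f : R -> R) (x : R) (j : nat) : R :=
  basis c n j x * f (INR j / n).

Definition B_op (c n : R) (f : R -> R) (x : R) : R :=
  Series (B_term c n f x).

Definition I_op (k : nat) (f : R -> R) (x : R) : R :=
  RInt (fun t => (x - t) ^ (k - 1) / INR (fact (k - 1)) * f t) 0 x.

Definition Bk_op (c n : R) (k : nat) (f : R -> R) : R -> R :=
  derive_n_on (Ic c) k (B_op c n (I_op k f)).

Definition V_op (c n : R) (k : nat) (f : R -> R) (x : R) : R :=
  n ^ k / rising c n k * Bk_op c n k f x.

Definition V_domain (c n : R) (k : nat) (f : R -> R) : Prop :=
  forall x, Ic c x -> ex_series (fun j => Rabs (B_term c n (I_op k f) x j)).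

Definition D_term (c n : R) (k : nat) (f : R -> R) (x : R) (j : nat) : R :=
  f ((2 * INR j + INR k) / (2 * n)) * basis c (n + INR k * c) j x.

Definition D_op (c n : R) (k : nat) (f : R -> R) (x : R) : R :=
  Series (D_term c n k f x).

Definition D_domain (c n : R) (k : nat) (f : R -> R) : Prop :=
  forall x, Ic c x -> ex_series (fun j => Rabs (D_term c n k f x j)).

(* Main.v *)
Require Import Defs.
From Stdlib Require Import Reals Lra Lia Factorial.
From Coquelicot Require Import Coquelicot.
Local Open Scope R_scope.

(** Termwise, [p_{m,j}' = m (p_{m+c,j-1} - p_{m+c,j})], so summation by parts gives
    [(sum a_j p_{m,j})' = m sum (a_{j+1} - a_j) p_{m+c,j}].  Iterating with
    [a_j = (I_k f)(j/n)] turns [V f] into [sum n^k (Delta^k a)_j p_{n+kc,j}], while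
    [D f] has the same basis functions with coefficients [f((2j+k)/(2n))].  The basis
    functions are nonnegative with sum 1, so it suffices to compare coefficients.
    [n^k (Delta^k a)_j] is a [k]-fold average of [f] over [[j/n, (j+k)/n]], centred at
    the midpoint [(2j+k)/(2n)]; this gives (ii) at once, and (i) by Taylor expansion at
    the midpoint, the averaged squared distance to it being [k/(12 n^2)].
    For [c >= 0] the series is a power series in [y = x/(1+cx)], which justifies
    differentiating termwise; for [c < 0] it is a finite sum. *)

(** Coquelicot states equalities at the carrier of an algebraic structure, where
    [ring] and [field] do not recognize [R]. *)
Ltac real_eq := match goal with |- ?u = ?v => change (@eq R u v) end.

(** * Derivatives relative to [Ic c] *)

Lemma D_in_ext (D : R -> Prop) (f g : R -> R) (l x : R) :
  (forall y, D y -> f y = g y) -> D x ->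
  D_in f (fun _ => l) D x -> D_in g (fun _ => l) D x.
Proof.
  intros Hfg Dx Hf eps Heps. destruct (Hf eps Heps) as [d [Hd H]].
  exists d; split; [exact Hd |]. intros y [[Dy Hne] Hy].
  rewrite <- (Hfg y Dy), <- (Hfg x Dx). apply H; repeat split; assumption.
Qed.

Lemma is_derive_D_in (D : R -> Prop) (f : R -> R) (x l : R) :
  is_derive f x l -> D_in f (fun _ => l) D x.
Proof.
  intros Hf. apply is_derive_Reals in Hf. intros eps Heps.
  destruct (Hf eps Heps) as [d Hd]. exists d; split; [apply cond_pos |].
  intros y [[Dy Hne] Hy]. simpl in Hy; unfold Rdist in Hy.
  simpl; unfold Rdist. replace (f y) with (f (x + (y - x))) by (f_equal; ring).
  apply Hd; [lra | exact Hy].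
Qed.

Lemma Ic_right_end (c : R) : c < 0 -> 0 < - (1 / c).
Proof.
  intros Hc. assert (/ c < 0) by (apply Rinv_lt_0_compat; exact Hc). lra.
Qed.

Lemma Ic_base_ge0 (c x : R) : Ic c x -> 0 <= 1 + c * x.
Proof.
  intros [H0 H1]. destruct (Rlt_dec c 0) as [Hc | Hc].
  - specialize (H1 Hc).
    assert (H : c * - (1 / c) <= c * x) by (apply Rmult_le_compat_neg_l; lra).
    replace (c * - (1 / c)) with (-1) in H by (field; lra). lra.
  - pose proof (Rmult_le_pos c x). lra.
Qed.

(** This makes relative derivatives unique on all of [Ic c], endpoints included. For [c < 0] the
    witness lies to the right of a point in the left half of the interval and to the left of any
    other point; the cap [b / 4] keeps it inside. *)
Lemma Ic_accumulation (c x : R) : Ic c x -> adhDa (D_x (Ic c) x) x.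
Proof.
  intros [Hx0 Hx1] e He.
  destruct (Rlt_dec c 0) as [Hc | Hc].
  - specialize (Hx1 Hc). pose proof (Ic_right_end c Hc) as Hr.
    set (b := - (1 / c)) in *.
    destruct (Rlt_dec x (b / 2)) as [Hb | Hb].
    + exists (x + Rmin (e / 2) (b / 4)).
      pose proof (Rmin_l (e / 2) (b / 4)); pose proof (Rmin_r (e / 2) (b / 4)).
      assert (0 < Rmin (e / 2) (b / 4)) by (apply Rmin_pos; lra).
      repeat split; try lra; [intros _; fold b; lra |].
      unfold Rdist; rewrite Rabs_pos_eq; lra.
    + exists (x - Rmin (e / 2) (b / 4)).
      pose proof (Rmin_l (e / 2) (b / 4)); pose proof (Rmin_r (e / 2) (b / 4)).
      assert (0 < Rmin (e / 2) (b / 4)) by (apply Rmin_pos; lra).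
      repeat split; try lra; [intros _; fold b; lra |].
      unfold Rdist; rewrite Rabs_left; lra.
  - exists (x + e / 2). repeat split; try lra.
    unfold Rdist; rewrite Rabs_pos_eq; lra.
Qed.

Lemma derive_on_unique (c : R) (f : R -> R) (x l : R) :
  Ic c x -> D_in f (fun _ => l) (Ic c) x -> derive_on (Ic c) f x = l.
Proof.
  intros Hx Hf. unfold derive_on. apply (iota_unique (V := R_CompleteNormedModule)).
  - intros y Hy. apply (single_limit _ _ _ _ _ (Ic_accumulation c x Hx) Hy Hf).
  - exact Hf.
Qed.

Lemma derive_on_correct (c : R) (f : R -> R) (x : R) :
  Ic c x -> ex_derive_on (Ic c) f x ->
  D_in f (fun _ => derive_on (Ic c) f x) (Ic c) x.
Proof.
  intros Hx [l Hl]. rewrite (derive_on_unique c f x l Hx Hl). exact Hl.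
Qed.

(** * Case [c >= 0]: power series in [x / (1 + c * x)] *)

(** With [y = x / (1 + c x)] and [c >= 0], the basis functions are
    [weight c m x * coef c m j * y ^ j], including the case [c = 0]. *)
Definition weight (c m x : R) : R :=
  if Req_EM_T c 0 then exp (- (m * x)) else Rpower (1 + c * x) (- (m / c)).

Lemma weight_pos (c m x : R) : 0 < weight c m x.
Proof.
  unfold weight. destruct (Req_EM_T c 0); apply exp_pos.
Qed.

Lemma weight_shift (c m x : R) :
  0 < 1 + c * x -> weight c (m + c) x = weight c m x / (1 + c * x).
Proof.
  intros H. unfold weight. destruct (Req_EM_T c 0) as [-> | Hc].
  - rewrite Rplus_0_r, Rmult_0_l, Rplus_0_r. field.
  - replace (- ((m + c) / c)) with (- (m / c) + Ropp 1) by (field; exact Hc).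
    rewrite Rpower_plus, (Rpower_Ropp _ 1), Rpower_1 by exact H. reflexivity.
Qed.

Lemma is_derive_weight (c m x : R) :
  0 < 1 + c * x -> is_derive (weight c m) x (- m * weight c (m + c) x).
Proof.
  intros H. rewrite weight_shift by exact H. unfold weight.
  destruct (Req_EM_T c 0) as [-> | Hc].
  - auto_derive; [trivial |]. field.
  - unfold Rpower. auto_derive; [exact H |]. field. split; lra.
Qed.

Definition coef (c m : R) (j : nat) : R := rising c m j / INR (fact j).

Lemma basis_weight (c m x : R) (j : nat) :
  0 <= c -> 0 <= x ->
  basis c m j x = weight c m x * (coef c m j * (x / (1 + c * x)) ^ j).
Proof.
  intros Hc Hx. assert (0 <= c * x) by (apply Rmult_le_pos; lra).
  unfold basis, weight, coef. destruct (Req_EM_T c 0) as [-> | Hc0].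
  - assert (E : rising 0 m j = m ^ j).
    { induction j as [| j IH]; simpl; [reflexivity |]. rewrite IH. ring. }
    rewrite E. replace (x / (1 + 0 * x)) with x by field. ring.
  - destruct (Rlt_dec c 0); [lra |]. unfold rpow.
    destruct (Req_EM_T (1 + c * x) 0); [lra |].
    rewrite Ropp_plus_distr, Rpower_plus, (Rpower_Ropp _ (INR j)), Rpower_pow by lra.
    unfold Rdiv. rewrite Rpow_mult_distr, pow_inv. ring.
Qed.

Lemma rising_shift (c m : R) (j : nat) : m * rising c (m + c) j = rising c m (S j).
Proof.
  induction j as [| j IH]; [simpl; ring |].
  change (rising c (m + c) (S j)) with (rising c (m + c) j * (m + c + c * INR j)).
  change (rising c m (S (S j))) with (rising c m (S j) * (m + c * INR (S j))).
  rewrite <- Rmult_assoc, IH, S_INR. ring.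
Qed.

Lemma coef_shift (c m : R) (j : nat) :
  m * coef c (m + c) j = (m + c * INR j) * coef c m j.
Proof.
  unfold coef. unfold Rdiv. rewrite <- Rmult_assoc, rising_shift. simpl rising. ring.
Qed.

(** With [coef_shift], this is the rule for [p_{m,j}'] at the level of coefficients: the same number
    [m * coef c (m + c) j] is a coefficient of the derived power series and also [m + c * INR j]
    times the original coefficient. *)
Lemma coef_derive (c m : R) (j : nat) :
  m * coef c (m + c) j = INR (S j) * coef c m (S j).
Proof.
  unfold coef, Rdiv. rewrite <- Rmult_assoc, rising_shift.
  rewrite fact_simpl, mult_INR. field.
  split; [apply INR_fact_neq_0 | apply not_0_INR; lia].
Qed.

Lemma ex_series_Rmult (r : R) (a : nat -> R) :
  ex_series a -> ex_series (fun j => r * a j).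
Proof.
  intros [l Hl]. exists (r * l). exact (is_series_scal (V := R_NormedModule) r a l Hl).
Qed.

(** The map [x / (1 + c * x)] is strictly increasing, so convergence at [x + 1] puts the radius at
    or above a value strictly larger than the one belonging to [x]. *)
Lemma radius_of_basis_series (c m : R) (a : nat -> R) :
  0 <= c ->
  (forall x, 0 <= x -> ex_series (fun j => Rabs (a j * basis c m j x))) ->
  forall x, 0 <= x ->
  Rbar_lt (Rabs (x / (1 + c * x))) (CV_radius (fun j => a j * coef c m j)).
Proof.
  intros Hc H x Hx. set (b := fun j => a j * coef c m j).
  assert (Hcx : 0 <= c * x) by (apply Rmult_le_pos; lra).
  assert (Hy0 : 0 <= x / (1 + c * x)) by (apply Rdiv_le_0_compat; lra).
  assert (Hlt : x / (1 + c * x) < (x + 1) / (1 + c * (x + 1))).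
  { apply Rminus_lt_0.
    replace ((x + 1) / (1 + c * (x + 1)) - x / (1 + c * x))
      with (/ ((1 + c * (x + 1)) * (1 + c * x))) by (field; lra).
    apply Rinv_0_lt_compat, Rmult_lt_0_compat; lra. }
  set (z := (x + 1) / (1 + c * (x + 1))) in *.
  apply Rbar_lt_le_trans with (Rabs z).
  { simpl. rewrite !Rabs_pos_eq; lra. }
  (* Beyond the radius the terms could not tend to 0, yet the series converges at [z]. *)
  apply Rbar_not_lt_le. intros Hout. apply (CV_disk_outside _ _ Hout).
  apply ex_series_lim_0, ex_series_Rabs.
  apply ex_series_ext
    with (fun j => / weight c m (x + 1) * Rabs (a j * basis c m j (x + 1))).
  - intros j. pose proof (weight_pos c m (x + 1)) as HW.
    rewrite basis_weight by lra. fold z.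
    replace (a j * (weight c m (x + 1) * (coef c m j * z ^ j)))
      with (weight c m (x + 1) * (b j * z ^ j)) by (unfold b; ring).
    rewrite (Rabs_mult (weight c m (x + 1))), (Rabs_pos_eq (weight c m (x + 1))) by lra.
    real_eq. field. lra.
  - apply ex_series_Rmult, H. lra.
Qed.

(** The sum is [weight c m x] times a power series P at y = x/(1+cx). As dy/dx = 1/(1+cx)^2, its
    derivative is [weight c (m + c) x] times P'(y)/(1+cx) - m P(y). Since 1/(1+cx) = 1 - cy, this is
    a combination of the three series P', P and yP', all with the same radius; the claimed series
    splits termwise in the same way. *)
Lemma basis_series_derive_nonneg (c m : R) (a : nat -> R) :
  0 <= c -> 0 < m ->
  (forall x, 0 <= x -> ex_series (fun j => Rabs (a j * basis c m j x))) ->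
  forall x, 0 <= x ->
  ex_series (fun j => Rabs ((a (S j) - a j) * basis c (m + c) j x)) /\
  D_in (fun x => Series (fun j => a j * basis c m j x))
    (fun _ => m * Series (fun j => (a (S j) - a j) * basis c (m + c) j x)) (Ic c) x.
Proof.
  intros Hc Hm H x Hx. pose proof (radius_of_basis_series c m a Hc H x Hx) as Hrad.
  set (b := fun j => a j * coef c m j) in *. set (y := x / (1 + c * x)) in *.
  assert (Hcx : 0 <= c * x) by (apply Rmult_le_pos; lra).
  pose proof (CV_disk_inside b y Hrad) as A1.
  assert (A2 : ex_series (fun j => Rabs (PS_derive b j * y ^ j))).
  { apply CV_disk_inside. rewrite CV_radius_derive. exact Hrad. }
  assert (A3 : ex_series (fun j => Rabs (PS_incr_1 (PS_derive b) j * y ^ j))).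
  { apply CV_disk_inside. rewrite CV_radius_incr_1, CV_radius_derive. exact Hrad. }
  assert (Hterm : forall j, (a (S j) - a j) * basis c (m + c) j x =
    weight c (m + c) x / m * (PS_derive b j * y ^ j - m * (b j * y ^ j)
      - c * (PS_incr_1 (PS_derive b) j * y ^ j))).
  { intros j. rewrite basis_weight by lra. fold y.
    replace (PS_incr_1 (PS_derive b) j) with (INR j * b j).
    2:{ destruct j; [simpl; unfold zero; simpl; ring | reflexivity]. }
    unfold PS_derive, b.
    transitivity (weight c (m + c) x / m * y ^ j *
      (a (S j) * (m * coef c (m + c) j) - a j * (m * coef c (m + c) j))).
    { field. lra. }
    (* The common factor is read in two ways: beside [a (S j)] as a coefficient of P', beside [a j]
       as the combination of P and yP'. *)
    rewrite coef_derive at 1. rewrite coef_shift. ring. }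
  split.
  - apply (ex_series_le (V := R_CompleteNormedModule)) with (fun j => weight c (m + c) x / m *
      (Rabs (PS_derive b j * y ^ j) + m * Rabs (b j * y ^ j)
        + c * Rabs (PS_incr_1 (PS_derive b) j * y ^ j))).
    + intros j. unfold norm; simpl; unfold abs; simpl. rewrite Rabs_Rabsolu, Hterm.
      assert (0 < weight c (m + c) x / m) by (apply Rdiv_lt_0_compat; [apply weight_pos | lra]).
      rewrite Rabs_mult, (Rabs_pos_eq (weight c (m + c) x / m)) by lra.
      apply Rmult_le_compat_l; [lra |].
      unfold Rminus. eapply Rle_trans; [apply Rabs_triang |].
      rewrite Rabs_Ropp, (Rabs_mult c), (Rabs_pos_eq c) by lra.
      apply Rplus_le_compat_r.
      eapply Rle_trans; [apply Rabs_triang |].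
      rewrite Rabs_Ropp, (Rabs_mult m), (Rabs_pos_eq m) by lra. lra.
    + apply ex_series_Rmult.
      apply (ex_series_plus (V := R_NormedModule));
        [apply (ex_series_plus (V := R_NormedModule)); [exact A2 |] |];
        apply ex_series_Rmult; assumption.
  - apply D_in_ext with (fun x => weight c m x * PSeries b (x / (1 + c * x))).
    { intros t [Ht _]. unfold PSeries. rewrite <- Series_scal_l. apply Series_ext.
      intros j. rewrite basis_weight by lra. unfold b. ring. }
    { split; [exact Hx | lra]. }
    apply is_derive_D_in.
    rewrite (Series_ext _ _ Hterm), Series_scal_l.
    assert (E1 := ex_series_Rabs _ A1). assert (E2 := ex_series_Rabs _ A2).
    assert (E3 := ex_series_Rabs _ A3).
    rewrite Series_minus, Series_minus, !Series_scal_l; try assumption.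
    2:{ apply ex_series_Rmult; assumption. }
    2:{ apply (ex_series_minus (V := R_NormedModule)); [assumption |].
        apply ex_series_Rmult; assumption. }
    2:{ apply ex_series_Rmult; assumption. }
    fold (PSeries b y). fold (PSeries (PS_derive b) y).
    fold (PSeries (PS_incr_1 (PS_derive b)) y).
    rewrite PSeries_incr_1.
    assert (Hy : is_derive (fun t => t / (1 + c * t)) x (/ (1 + c * x) ^ 2)).
    { auto_derive; [lra |]. field. lra. }
    assert (HP := is_derive_comp (PSeries b) (fun t => t / (1 + c * t)) x _ _
      (is_derive_PSeries b y Hrad) Hy).
    assert (HW := is_derive_weight c m x ltac:(lra)).
    assert (HM := is_derive_mult _ _ _ _ _ HW HP Rmult_comm).
    eapply is_derive_ext; [intros t; reflexivity |].
    match type of HM with is_derive _ _ ?l => match goal with |- is_derive _ _ ?r =>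
      replace r with l; [exact HM |] end end.
    unfold plus, mult, scal; simpl; unfold mult; simpl. fold y.
    rewrite weight_shift by lra.
    generalize (PSeries b y) (PSeries (PS_derive b) y). intros P P'.
    unfold y. field. lra.
Qed.

(** * Case [c < 0]: finite sums of Bernstein type *)

Lemma rising_eq0 (c : R) (M j : nat) : (M < j)%nat -> rising c (- c * INR M) j = 0.
Proof.
  induction j as [| j IH]; [lia |]. intros H. simpl.
  destruct (Nat.eq_dec j M) as [-> | Hne]; [ring |]. rewrite IH by lia. ring.
Qed.

(** For [m = - c M] these are the basis functions; beyond [j = M] they vanish through
    [coef], so the truncated exponent [M - j] is harmless. *)
Definition bernstein_term (c : R) (M j : nat) (x : R) : R :=
  coef c (- c * INR M) j * x ^ j * (1 + c * x) ^ (M - j).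

Lemma bernstein_term_eq0 (c : R) (M j : nat) (x : R) :
  (M < j)%nat -> bernstein_term c M j x = 0.
Proof.
  intros H. unfold bernstein_term, coef. rewrite rising_eq0 by exact H.
  unfold Rdiv. ring.
Qed.

Lemma basis_neg (c : R) (M j : nat) (x : R) :
  c < 0 -> Ic c x -> basis c (- c * INR M) j x = bernstein_term c M j x.
Proof.
  intros Hc Hx. unfold basis.
  destruct (Req_EM_T c 0); [lra |]. destruct (Rlt_dec c 0); [| lra].
  replace (- (- c * INR M / c)) with (INR M) by (field; lra).
  destruct (Rlt_dec (INR M) (INR j)) as [Hj | Hj].
  - rewrite bernstein_term_eq0; [reflexivity | apply INR_lt; exact Hj].
  - assert (HjM : (j <= M)%nat) by (apply INR_le; lra).
    replace (- (- c * INR M / c + INR j)) with (INR (M - j))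
      by (rewrite minus_INR by exact HjM; field; lra).
    unfold bernstein_term, coef. f_equal. unfold rpow.
    destruct (Req_EM_T (1 + c * x) 0) as [E | E].
    + rewrite E. destruct (Req_EM_T (INR (M - j)) 0) as [E' | E'].
      * apply (INR_eq _ 0) in E'. rewrite E'. reflexivity.
      * rewrite pow_i; [reflexivity |]. apply INR_lt. simpl.
        pose proof (pos_INR (M - j)). lra.
    + apply Rpower_pow. pose proof (Ic_base_ge0 c x Hx). lra.
Qed.

Lemma is_series_finite (a : nat -> R) (M : nat) :
  (forall j, (M < j)%nat -> a j = 0) -> is_series a (sum_n a M).
Proof.
  intros H. apply (is_lim_seq_ext_loc (fun _ => sum_n a M) (sum_n a) (sum_n a M)).
  - exists M. intros K HK. induction HK as [| K HK IH]; [reflexivity |].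
    rewrite sum_Sn, <- IH, H by lia. exact (eq_sym (Rplus_0_r _)).
  - apply is_lim_seq_const.
Qed.

(** [auto_derive] unfolds [INR (S K)] when it differentiates a power. *)
Ltac fold_INR := repeat match goal with
  |- context [match ?K with O => 1 | S _ => INR ?K + 1 end] =>
    change (match K with O => 1 | S _ => INR K + 1 end) with (INR (S K))
  end.

(** For the parameter m = -c(M+1) one has m + c = -cM. The three cases follow the truncated
    exponent: for j <= M it drops by one under differentiation, at j = M+1 it is already 0, and for
    larger j every coefficient involved vanishes. *)
Lemma is_derive_bernstein_term (c : R) (M j : nat) (x : R) :
  is_derive (bernstein_term c (S M) j) x
    (- c * INR (S M) *
      ((match j with O => 0 | S i => bernstein_term c M i x end)
        - bernstein_term c M j x)).
Proof.
  set (m := - c * INR (S M)).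
  assert (Em : - c * INR M = m + c) by (unfold m; rewrite S_INR; ring).
  unfold bernstein_term. rewrite Em. fold m.
  destruct (Compare_dec.lt_eq_lt_dec j (S M)) as [[Hj | Hj] | Hj].
  - replace (S M - j)%nat with (S (M - j)) by lia.
    assert (Hr : m + c * INR j = - c * INR (S (M - j))).
    { unfold m. rewrite !S_INR, minus_INR by lia. ring. }
    assert (Hs := coef_shift c m j). rewrite Hr in Hs.
    destruct j as [| i].
    + rewrite Nat.sub_0_r in *. auto_derive; [trivial |]. simpl pred.
      transitivity (- (1 + c * x) ^ M * (- c * INR (S M) * coef c m 0)); [simpl pow; fold_INR; ring |].
      rewrite <- Hs. ring.
    + assert (Hd := coef_derive c m i). replace (M - i)%nat with (S (M - S i)) by lia.
      auto_derive; [trivial |]. simpl pred.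
      transitivity (INR (S i) * coef c m (S i) * x ^ i * (1 + c * x) ^ S (M - S i)
        - x ^ S i * (1 + c * x) ^ (M - S i) * (- c * INR (S (M - S i)) * coef c m (S i)));
        [simpl pow; fold_INR; ring |].
      rewrite <- Hs, <- Hd. ring.
  - subst j. rewrite !Nat.sub_diag.
    assert (E0 : coef c (m + c) (S M) = 0).
    { unfold coef. rewrite <- Em, rising_eq0 by lia. unfold Rdiv. ring. }
    rewrite E0. assert (Hd := coef_derive c m M).
    auto_derive; [trivial |]. simpl pred.
    transitivity (INR (S M) * coef c m (S M) * x ^ M); [simpl pow; fold_INR; ring |].
    rewrite <- Hd. simpl pow. ring.
  - assert (E0 : forall i, (M < i)%nat -> coef c (m + c) i = 0).
    { intros i Hi. unfold coef. rewrite <- Em, rising_eq0 by lia. unfold Rdiv. ring. }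
    assert (E1 : coef c m j = 0).
    { unfold coef, m. rewrite rising_eq0 by lia. unfold Rdiv. ring. }
    rewrite E1. destruct j as [| i]; [lia |].
    rewrite (E0 i), (E0 (S i)) by lia.
    auto_derive; [trivial |]. ring.
Qed.

Lemma summation_by_parts (a q : nat -> R) (K : nat) :
  sum_n (fun j => a j * ((match j with O => 0 | S i => q i end) - q j)) K
    = sum_n (fun j => (a (S j) - a j) * q j) K - a (S K) * q K.
Proof.
  induction K as [| K IH].
  - rewrite !sum_O. real_eq. ring.
  - rewrite !sum_Sn, IH. unfold plus; simpl. real_eq. ring.
Qed.

Lemma ex_series_basis_neg (c : R) (M : nat) (a : nat -> R) (x : R) :
  c < 0 -> Ic c x -> ex_series (fun j => Rabs (a j * basis c (- c * INR M) j x)).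
Proof.
  intros Hc Hx. eexists. apply is_series_finite with (M := M). intros j Hj.
  rewrite basis_neg, bernstein_term_eq0 by assumption. rewrite Rmult_0_r. apply Rabs_R0.
Qed.

Lemma basis_series_derive_neg (c : R) (M : nat) (a : nat -> R) (x : R) :
  c < 0 -> Ic c x -> let m := - c * INR (S M) in
  D_in (fun x => Series (fun j => a j * basis c m j x))
    (fun _ => m * Series (fun j => (a (S j) - a j) * basis c (m + c) j x)) (Ic c) x.
Proof.
  intros Hc Hx m.
  assert (Em : m + c = - c * INR M) by (unfold m; rewrite S_INR; ring).
  (* The single upper limit [S M] serves both parameters: [N = S M] for [m] and [N = M] for
     [m + c]. *)
  assert (Hfin : forall N b y, Ic c y -> (N <= S M)%nat ->
    Series (fun j => b j * basis c (- c * INR N) j y)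
      = sum_n (fun j => b j * bernstein_term c N j y) (S M)).
  { intros N b y Hy HN. apply is_series_unique.
    apply (is_series_ext (fun j => b j * bernstein_term c N j y)).
    - intros j. rewrite basis_neg by assumption. reflexivity.
    - apply is_series_finite. intros j Hj. rewrite bernstein_term_eq0 by lia. ring. }
  apply D_in_ext with (fun x => sum_n (fun j => a j * bernstein_term c (S M) j x) (S M)).
  { intros y Hy. symmetry. apply Hfin; [exact Hy | lia]. }
  { exact Hx. }
  apply is_derive_D_in. rewrite Em, Hfin by (assumption || lia).
  assert (Hp := summation_by_parts a (fun j => bernstein_term c M j x) (S M)). cbv beta in Hp.
  (* The boundary term of the summation by parts disappears because its basis function has index
     beyond [M]. *)
  rewrite (bernstein_term_eq0 c M (S M)), Rmult_0_r, Rminus_0_r in Hp by lia.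
  rewrite <- Hp.
  rewrite <- (sum_n_mult_l (K := R_Ring)).
  apply (is_derive_sum_n (V := R_NormedModule)
    (fun j x => a j * bernstein_term c (S M) j x)).
  intros j _.
  replace (mult m _) with (a j * (- c * INR (S M) *
      ((match j with O => 0 | S i => bernstein_term c M i x end)
        - bernstein_term c M j x))).
  - apply is_derive_scal, is_derive_bernstein_term.
  - real_eq. match goal with |- _ = mult ?u ?v => change (mult u v) with (u * v) end.
    fold m. ring.
Qed.

(** * Extension from [Ic c] to the line, and the mean value theorem *)

(** The nearest-point retraction onto [Ic c]. Composing with it turns a function continuous on
    [Ic c] into one continuous everywhere with the same values on [Ic c], so that theorems about
    functions on the whole line apply. *)
Definition clamp (c x : R) : R :=
  if Rlt_dec c 0 then Rmax 0 (Rmin x (- (1 / c))) else Rmax 0 x.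

Lemma clamp_Ic (c x : R) : Ic c (clamp c x).
Proof.
  unfold clamp, Ic. destruct (Rlt_dec c 0) as [Hc | Hc].
  - pose proof (Ic_right_end c Hc). split; [apply Rmax_l |]. intros _.
    apply Rmax_lub; [lra | apply Rmin_r].
  - split; [apply Rmax_l |]. lra.
Qed.

Lemma clamp_id (c x : R) : Ic c x -> clamp c x = x.
Proof.
  intros [H0 H1]. unfold clamp. destruct (Rlt_dec c 0) as [Hc | Hc].
  - specialize (H1 Hc). rewrite Rmin_left, Rmax_right; lra.
  - rewrite Rmax_right; lra.
Qed.

Lemma clamp_lipschitz (c x y : R) : Rabs (clamp c y - clamp c x) <= Rabs (y - x).
Proof.
  apply Rabs_le. pose proof (Rle_abs (y - x)). pose proof (Rcomplements.Rabs_maj2 (y - x)).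
  unfold clamp, Rmax, Rmin. destruct (Rlt_dec c 0); repeat destruct (Rle_dec _ _); lra.
Qed.

Lemma continuous_clamp (c : R) (f : R -> R) :
  continuous_on (Ic c) f -> forall x, continuous (fun t => f (clamp c t)) x.
Proof.
  intros Hf x. apply filterlim_comp with (2 := Hf (clamp c x) (clamp_Ic c x)).
  intros P [eps HP]. exists eps. intros y Hy. apply HP; [| apply clamp_Ic].
  eapply Rle_lt_trans; [apply clamp_lipschitz | exact Hy].
Qed.

Lemma Ic_between (c a b x : R) : Ic c a -> Ic c b -> a <= x <= b -> Ic c x.
Proof.
  intros [Ha0 _] [_ Hb1] Hx. split; [lra |]. intros Hc. specialize (Hb1 Hc). lra.
Qed.

Lemma D_in_continuous_on (D : R -> Prop) (f df : R -> R) :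
  (forall x, D x -> D_in f (fun _ => df x) D x) -> continuous_on D f.
Proof.
  intros H x Dx P [eps HP].
  destruct (cont_deriv f _ D x (H x Dx) eps (cond_pos eps)) as [d [Hd Hlim]].
  exists (mkposreal d Hd). intros y Hy Dy. apply HP.
  destruct (Req_dec x y) as [<- | Hne]; [apply ball_center |].
  apply Hlim. split; [split; assumption | exact Hy].
Qed.

(** The bounds [a < x < b] make [x] interior, so small increments stay in [Ic c], where [clamp] is
    the identity. *)
Lemma D_in_is_derive_clamp (c : R) (f : R -> R) (l a b x : R) :
  Ic c a -> Ic c b -> a < x < b ->
  D_in f (fun _ => l) (Ic c) x -> is_derive (fun t => f (clamp c t)) x l.
Proof.
  intros Ha Hb Hx Hf. apply is_derive_Reals. intros eps Heps.
  destruct (Hf eps Heps) as [d [Hd H]].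
  assert (Hr : 0 < Rmin d (Rmin (x - a) (b - x))) by (repeat apply Rmin_pos; lra).
  exists (mkposreal _ Hr). intros h Hh0 Hh. simpl in Hh.
  apply Rmin_Rgt in Hh. destruct Hh as [Hhd Hh]. apply Rmin_Rgt in Hh.
  destruct Hh as [Hha Hhb]. apply Rgt_lt, Rabs_def2 in Hha. apply Rgt_lt, Rabs_def2 in Hhb.
  assert (Hxh : Ic c (x + h)) by (apply (Ic_between c a b); [exact Ha | exact Hb | lra]).
  rewrite !clamp_id; [| apply (Ic_between c a b); [exact Ha | exact Hb | lra] | exact Hxh].
  specialize (H (x + h)). simpl in H. unfold Rdist in H.
  replace (x + h - x) with h in H by ring. apply H.
  split; [split; [exact Hxh | lra] | exact Hhd].
Qed.

(** Two-sided derivatives are required only strictly between [a] and [b]; at the ends continuity is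
    enough, and relative differentiability supplies it. *)
Lemma Ic_MVT (c : R) (f df : R -> R) (a b : R) :
  (forall x, Ic c x -> D_in f (fun _ => df x) (Ic c) x) -> Ic c a -> Ic c b ->
  exists xi, Rmin a b <= xi <= Rmax a b /\ f b - f a = df xi * (b - a).
Proof.
  intros Hf Ha Hb.
  assert (Hmin : Ic c (Rmin a b)) by (unfold Rmin; destruct (Rle_dec a b); assumption).
  assert (Hmax : Ic c (Rmax a b)) by (unfold Rmax; destruct (Rle_dec a b); assumption).
  destruct (MVT_gen (fun t => f (clamp c t)) a b df) as [xi [Hxi E]].
  - intros x Hx. apply (D_in_is_derive_clamp c f _ (Rmin a b) (Rmax a b)); try assumption.
    apply Hf, (Ic_between c (Rmin a b) (Rmax a b)); [assumption | assumption | lra].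
  - intros x _. apply continuity_pt_filterlim, continuous_clamp.
    apply (D_in_continuous_on _ _ df Hf).
  - rewrite !clamp_id in E by assumption. exists xi. split; assumption.
Qed.

(** * Iterated termwise differentiation *)

Lemma basis_series_derive (c m : R) (a : nat -> R) :
  (0 <= c -> 0 < m) -> (c < 0 -> exists M, m = - c * INR (S M)) ->
  (forall x, Ic c x -> ex_series (fun j => Rabs (a j * basis c m j x))) ->
  forall x, Ic c x ->
  ex_series (fun j => Rabs ((a (S j) - a j) * basis c (m + c) j x)) /\
  D_in (fun x => Series (fun j => a j * basis c m j x))
    (fun _ => m * Series (fun j => (a (S j) - a j) * basis c (m + c) j x)) (Ic c) x.
Proof.
  intros Hpos Hneg H x Hx. destruct (Rlt_dec c 0) as [Hc | Hc].
  - destruct (Hneg Hc) as [M ->]. split.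
    + replace (- c * INR (S M) + c) with (- c * INR M) by (rewrite S_INR; ring).
      apply (ex_series_basis_neg c M (fun j => a (S j) - a j)); assumption.
    + apply basis_series_derive_neg; assumption.
  - apply Rnot_lt_le in Hc. apply basis_series_derive_nonneg; [exact Hc | auto | | apply Hx].
    intros y Hy. apply H. split; [exact Hy | lra].
Qed.

Fixpoint fdiff (k : nat) (a : nat -> R) : nat -> R :=
  match k with
  | O => a
  | S k' => fun j => fdiff k' a (S j) - fdiff k' a j
  end.

(** Each differentiation raises the parameter by [c] and contributes a factor [n + INR i * c], which
    accumulate to [rising c n k]. Absolute convergence at the raised parameter is carried through
    the induction because the next differentiation relies on it. *)
Lemma derive_n_basis_series (c n : R) (k : nat) (a : nat -> R) (g : R -> R) :
  (forall i, (i < k)%nat -> 0 <= c -> 0 < n + INR i * c) ->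
  (forall i, (i < k)%nat -> c < 0 -> exists M, n + INR i * c = - c * INR (S M)) ->
  (forall x, Ic c x -> ex_series (fun j => Rabs (a j * basis c n j x))) ->
  (forall x, Ic c x -> g x = Series (fun j => a j * basis c n j x)) ->
  forall x, Ic c x ->
  ex_series (fun j => Rabs (fdiff k a j * basis c (n + INR k * c) j x)) /\
  derive_n_on (Ic c) k g x
    = rising c n k * Series (fun j => fdiff k a j * basis c (n + INR k * c) j x).
Proof.
  intros Hpos Hneg Ha Hg. induction k as [| k IH].
  - intros x Hx. simpl. replace (n + 0 * c) with n by ring.
    split; [apply Ha, Hx |]. rewrite Hg by exact Hx. ring.
  - assert (IH' := IH (fun i Hi => Hpos i (Nat.lt_lt_succ_r _ _ Hi))
      (fun i Hi => Hneg i (Nat.lt_lt_succ_r _ _ Hi))). clear IH.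
    intros x Hx.
    destruct (basis_series_derive c (n + INR k * c) (fdiff k a)
      (Hpos k (Nat.lt_succ_diag_r k)) (Hneg k (Nat.lt_succ_diag_r k))
      (fun y Hy => proj1 (IH' y Hy)) x Hx) as [Hex HD].
    replace (n + INR k * c + c) with (n + INR (S k) * c) in * by (rewrite S_INR; ring).
    split; [exact Hex |].
    apply derive_on_unique; [exact Hx |].
    apply D_in_ext with (fun y => rising c n k *
      Series (fun j => fdiff k a j * basis c (n + INR k * c) j y)).
    { intros y Hy. symmetry. apply IH', Hy. }
    { exact Hx. }
    simpl rising.
    replace (rising c n k * (n + c * INR k) * _) with (rising c n k * ((n + INR k * c) *
      Series (fun j => fdiff (S k) a j * basis c (n + INR (S k) * c) j x))) by ring.
    exact (Dmult_const _ _ _ _ _ HD).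
Qed.

(** * Basis functions: nonnegativity, convergence, sum 1 *)

Lemma coef_pos (c m : R) (j : nat) : 0 <= c -> 0 < m -> 0 < coef c m j.
Proof.
  intros Hc Hm. apply Rdiv_lt_0_compat; [| apply INR_fact_lt_0].
  induction j as [| j IH]; simpl; [lra |]. apply Rmult_lt_0_compat; [exact IH |].
  pose proof (Rmult_le_pos c (INR j) Hc (pos_INR j)). lra.
Qed.

Lemma coef_neg_ge0 (c : R) (M j : nat) : c < 0 -> 0 <= coef c (- c * INR M) j.
Proof.
  intros Hc. apply Rdiv_le_0_compat; [| apply INR_fact_lt_0].
  induction j as [| j IH]; simpl; [lra |].
  destruct (Nat.lt_ge_cases M j) as [Hj | Hj].
  - rewrite rising_eq0 by exact Hj. lra.
  - apply Rmult_le_pos; [exact IH |].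
    replace (- c * INR M + c * INR j) with (- c * (INR M - INR j)) by ring.
    apply le_INR in Hj. apply Rmult_le_pos; lra.
Qed.

Lemma basis_ge0 (c m x : R) (j : nat) :
  (0 <= c -> 0 < m) -> (c < 0 -> exists M, m = - c * INR M) ->
  Ic c x -> 0 <= basis c m j x.
Proof.
  intros Hpos Hneg Hx. pose proof (Ic_base_ge0 c x Hx) as Hb. pose proof Hx as [Hx0 _].
  destruct (Rlt_dec c 0) as [Hc | Hc].
  - destruct (Hneg Hc) as [M ->]. rewrite basis_neg by assumption.
    unfold bernstein_term. pose proof (coef_neg_ge0 c M j Hc).
    apply Rmult_le_pos; [apply Rmult_le_pos |]; try apply pow_le; assumption.
  - apply Rnot_lt_le in Hc. rewrite basis_weight by assumption.
    pose proof (Rmult_le_pos c x Hc Hx0).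
    apply Rmult_le_pos; [apply Rlt_le, weight_pos |].
    apply Rmult_le_pos; [apply Rlt_le, coef_pos; auto |].
    apply pow_le, Rdiv_le_0_compat; lra.
Qed.

(** The ratio of consecutive coefficients is (m+cj)/(j+1) = c + (m-c)/(j+1), which tends to [c]. So
    the radius is 1/c, or infinite for [c = 0], while x/(1+cx) stays below 1/c. *)
Lemma coef_radius (c m x : R) :
  0 <= c -> 0 < m -> 0 <= x -> Rbar_lt (Rabs (x / (1 + c * x))) (CV_radius (coef c m)).
Proof.
  intros Hc Hm Hx.
  assert (Hne : forall j, coef c m j <> 0).
  { intros j. apply Rgt_not_eq, coef_pos; assumption. }
  assert (Hlim : is_lim_seq (fun j => Rabs (coef c m (S j) / coef c m j)) c).
  { apply is_lim_seq_ext with (fun j => c + (m - c) * / INR (S j)).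
    - intros j. assert (0 < INR (S j)) by (apply lt_0_INR; lia).
      rewrite Rabs_pos_eq.
      2:{ apply Rlt_le, Rdiv_lt_0_compat; apply coef_pos; assumption. }
      apply Rmult_eq_reg_r with (INR (S j) * coef c m j);
        [| apply Rmult_integral_contrapositive_currified; [lra | apply Hne]].
      transitivity ((m + c * INR j) * coef c m j).
      { rewrite S_INR in *. field. lra. }
      rewrite <- coef_shift, coef_derive. field. apply Hne.
    - replace (Finite c) with (Rbar_plus c (Rbar_mult (m - c) 0))
        by (simpl; f_equal; ring).
      apply is_lim_seq_plus'; [apply is_lim_seq_const |].
      apply (is_lim_seq_scal_l _ (m - c) 0).
      apply (is_lim_seq_incr_1 (fun j => / INR j)).
      apply (is_lim_seq_inv _ p_infty); [apply is_lim_seq_INR | discriminate]. }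
  destruct Hc as [Hc | <-].
  - rewrite (CV_radius_finite_DAlembert _ c Hne Hc Hlim). simpl.
    assert (0 <= c * x) by (apply Rmult_le_pos; lra).
    rewrite Rabs_pos_eq by (apply Rdiv_le_0_compat; lra).
    apply Rminus_lt_0. replace (/ c - x / (1 + c * x)) with (/ (c * (1 + c * x))) by (field; lra).
    apply Rinv_0_lt_compat, Rmult_lt_0_compat; lra.
  - rewrite (CV_radius_infinite_DAlembert _ Hne Hlim). exact I.
Qed.

(** The factor 1 presents this as a series with constant coefficient sequence, the form that
    [basis_series_derive] takes. *)
Lemma ex_series_basis (c m x : R) :
  (0 <= c -> 0 < m) -> (c < 0 -> exists M, m = - c * INR M) ->
  Ic c x -> ex_series (fun j => Rabs (1 * basis c m j x)).
Proof.
  intros Hpos Hneg Hx. destruct (Rlt_dec c 0) as [Hc | Hc].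
  - destruct (Hneg Hc) as [M ->]. apply (ex_series_basis_neg c M (fun _ => 1)); assumption.
  - apply Rnot_lt_le in Hc. destruct Hx as [Hx _].
    apply ex_series_ext with (fun j => weight c m x *
      Rabs (coef c m j * (x / (1 + c * x)) ^ j)).
    + intros j. real_eq. pose proof (weight_pos c m x).
      rewrite basis_weight, Rmult_1_l, (Rabs_mult (weight c m x)) by assumption.
      rewrite (Rabs_pos_eq (weight c m x)) by lra. reflexivity.
    + apply ex_series_Rmult, CV_disk_inside, coef_radius; auto.
Qed.

Lemma basis_at_0 (c m : R) (j : nat) :
  (c < 0 -> exists M, m = - c * INR M) -> basis c m j 0 = match j with O => 1 | S _ => 0 end.
Proof.
  intros Hneg. assert (E : coef c m 0 = 1) by (unfold coef; simpl; field).
  destruct (Rlt_dec c 0) as [Hc | Hc].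
  - destruct (Hneg Hc) as [M ->]. rewrite basis_neg; [| exact Hc |].
    + unfold bernstein_term. rewrite Rmult_0_r, Rplus_0_r, pow1.
      destruct j; [rewrite E | simpl]; ring.
    + split; [lra |]. intros _. apply Rlt_le, Ic_right_end, Hc.
  - apply Rnot_lt_le in Hc. rewrite basis_weight by lra.
    replace (0 / (1 + c * 0)) with 0 by (field; lra).
    destruct j; [| simpl; ring]. rewrite E. unfold weight.
    destruct (Req_EM_T c 0).
    + rewrite Rmult_0_r, Ropp_0, exp_0. ring.
    + unfold Rpower. rewrite Rmult_0_r, Rplus_0_r, ln_1, Rmult_0_r, exp_0. ring.
Qed.

(** The difference sequence of the constant sequence 1 vanishes, so the sum of the
    basis functions has zero derivative. *)
Lemma basis_partition_of_unity (c m x : R) :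
  (0 <= c -> 0 < m) -> (c < 0 -> exists M, m = - c * INR (S M)) ->
  Ic c x -> Series (fun j => basis c m j x) = 1.
Proof.
  intros Hpos Hneg Hx.
  assert (Hneg' : c < 0 -> exists M, m = - c * INR M).
  { intros Hc. destruct (Hneg Hc) as [M HM]. exists (S M). exact HM. }
  assert (H0 : Ic c 0).
  { split; [lra |]. intros Hc. apply Rlt_le, Ic_right_end, Hc. }
  assert (HD : forall y, Ic c y ->
    D_in (fun x => Series (fun j => 1 * basis c m j x)) (fun _ => 0) (Ic c) y).
  { intros y Hy. destruct (basis_series_derive c m (fun _ => 1) Hpos Hneg
      (fun z Hz => ex_series_basis c m z Hpos Hneg' Hz) y Hy) as [_ H].
    rewrite (Series_ext _ (fun j => 0 * basis c (m + c) j y)) in H by (intros; ring).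
    rewrite Series_scal_l in H.
    replace (m * (0 * _)) with 0 in H by ring. exact H. }
  destruct (Ic_MVT c _ (fun _ => 0) 0 x HD H0 Hx) as [xi [_ E]].
  rewrite Rmult_0_l in E.
  assert (E0 : Series (fun j => 1 * basis c m j 0) = 1).
  { transitivity (sum_n (fun j => 1 * basis c m j 0) 0).
    - apply is_series_unique, is_series_finite. intros [| j] Hj; [lia |].
      rewrite basis_at_0 by exact Hneg'. ring.
    - rewrite sum_O, basis_at_0 by exact Hneg'. real_eq. ring. }
  rewrite (Series_ext _ (fun j => 1 * basis c m j x)) by (intros; ring). lra.
Qed.

(** * Finite differences of iterated antiderivatives *)

Lemma fdiff_ext (k : nat) (a b : nat -> R) :
  (forall j, a j = b j) -> forall j, fdiff k a j = fdiff k b j.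
Proof.
  intros H. induction k as [| k IH]; intros j; simpl; [apply H |]. rewrite !IH. reflexivity.
Qed.

(** Moves one difference to the innermost place, where it can be absorbed into the sampled
    function. *)
Lemma fdiff_succ (k : nat) (a : nat -> R) (j : nat) :
  fdiff (S k) a j = fdiff k (fun i => a (S i) - a i) j.
Proof.
  revert j. induction k as [| k IH]; intros j; [reflexivity |].
  change (fdiff (S k) a (S j) - fdiff (S k) a j
    = fdiff (S k) (fun i => a (S i) - a i) j).
  rewrite !IH. reflexivity.
Qed.

Lemma fdiff_opp (k : nat) (a : nat -> R) (j : nat) :
  fdiff k (fun i => - a i) j = - fdiff k a j.
Proof.
  revert j. induction k as [| k IH]; intros j; simpl; [reflexivity |]. rewrite !IH. ring.
Qed.

(** The lower bound is the [k]-fold forward difference of the [k]-fold antiderivative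
    of the quadratic: averaging a quadratic over [[t, t + h]] recentres it by [h / 2]
    and adds [ga h^2 / 12]. *)
Lemma fdiff_antiderivative_ge (h : R) (k : nat) (F : nat -> R -> R) (al be ga mu : R) (j : nat) :
  0 < h -> (forall l t, is_derive (F (S l)) t (F l t)) ->
  (forall t, INR j * h <= t <= (INR j + INR k) * h ->
    al + be * (t - mu) + ga * (t - mu) ^ 2 <= F O t) ->
  let d := (INR j + INR k / 2) * h - mu in
  h ^ k * (al + ga * INR k * h ^ 2 / 12 + be * d + ga * d ^ 2)
    <= fdiff k (fun i => F k (INR i * h)) j.
Proof.
  intros Hh. revert F al be ga mu. induction k as [| k IH]; intros F al be ga mu HF H d.
  - simpl fdiff. eapply Rle_trans; [| apply H; simpl; lra].
    unfold d. simpl. right. field.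
  (* [Phi] is again a chain of antiderivatives, and its bottom member is the integral of [F O] over
     [t, t+h]; this spends one difference and one antiderivative, so the induction hypothesis
     applies to it. *)
  - set (Phi := fun l t => F (S l) (t + h) - F (S l) t).
    assert (HPhi : forall l t, is_derive (Phi (S l)) t (Phi l t)).
    { intros l t. unfold Phi. apply (is_derive_minus (V := R_NormedModule)); [| apply HF].
      rewrite <- (Rmult_1_l (F (S l) (t + h))).
      apply (is_derive_comp (F (S (S l))) (fun t => t + h)); [apply HF |].
      auto_derive; [trivial | ring]. }
    rewrite fdiff_succ.
    rewrite (fdiff_ext _ _ (fun i => Phi k (INR i * h))).
    2:{ intros i. unfold Phi. rewrite S_INR. do 2 f_equal. ring. }
    eapply Rle_trans;
      [| apply (IH Phi (h * (al + ga * h ^ 2 / 12)) (h * be) (h * ga) (mu - h / 2) HPhi)].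
    + right. unfold d. rewrite S_INR. simpl pow. field.
    + intros t Ht. unfold Phi.
      (* [Q] is an antiderivative of the lower quadratic. The mean value theorem for [F 1 - Q] on
         [t, t+h] compares the two integrals through increments alone. *)
      set (Q := fun s => al * s + be * (s - mu) ^ 2 / 2 + ga * (s - mu) ^ 3 / 3).
      destruct (MVT_gen (fun s => F 1%nat s - Q s) t (t + h)
        (fun s => F O s - (al + be * (s - mu) + ga * (s - mu) ^ 2))) as [xi [Hxi E]].
      { intros s _. apply (is_derive_minus (V := R_NormedModule)); [apply HF |].
        unfold Q. auto_derive; [trivial |]. field. }
      { intros s _. apply continuity_pt_minus.
        - apply continuity_pt_filterlim, (ex_derive_continuous (V := R_NormedModule)).
          exists (F O s). apply HF.
        - apply continuity_pt_filterlim, (ex_derive_continuous (V := R_NormedModule)).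
          unfold Q. auto_derive. trivial. }
      rewrite Rmin_left, Rmax_right in Hxi by lra.
      assert (0 <= (F O xi - (al + be * (xi - mu) + ga * (xi - mu) ^ 2)) * h).
      { apply Rmult_le_pos; [| lra].
        assert (al + be * (xi - mu) + ga * (xi - mu) ^ 2 <= F O xi);
          [apply H; rewrite S_INR; nra | lra]. }
      replace (t + h - t) with h in E by ring.
      assert (EQ : Q (t + h) - Q t = h * (al + ga * h ^ 2 / 12) + h * be * (t - (mu - h / 2))
        + h * ga * (t - (mu - h / 2)) ^ 2) by (unfold Q; field).
      lra.
Qed.

(** * The operator [I_op] as a repeated integral *)

Fixpoint antiderivative (g : R -> R) (k : nat) : R -> R :=
  match k with
  | O => g
  | S k' => fun x => RInt (antiderivative g k') 0 x
  end.

Lemma is_derive_RInt_continuous (h : R -> R) (x : R) :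
  (forall y, continuous h y) -> is_derive (fun y => RInt h 0 y) x (h x).
Proof.
  intros Hh. apply (is_derive_RInt (V := R_NormedModule) h _ 0 x); [| apply Hh].
  exists (mkposreal 1 Rlt_0_1). intros y _.
  apply (RInt_correct (V := R_CompleteNormedModule)), ex_RInt_continuous.
  intros z _. apply Hh.
Qed.

Lemma antiderivative_continuous (g : R -> R) (k : nat) :
  (forall x, continuous g x) -> forall x, continuous (antiderivative g k) x.
Proof.
  intros Hg. induction k as [| k IH]; intros x; [apply Hg |].
  apply (ex_derive_continuous (V := R_NormedModule)). exists (antiderivative g k x).
  apply is_derive_RInt_continuous, IH.
Qed.

Lemma is_derive_antiderivative (g : R -> R) (k : nat) (x : R) :
  (forall x, continuous g x) ->
  is_derive (antiderivative g (S k)) x (antiderivative g k x).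
Proof.
  intros Hg. apply is_derive_RInt_continuous, antiderivative_continuous, Hg.
Qed.

Lemma continuous_kernel (g : R -> R) (j i : nat) (x t : R) :
  (forall x, continuous g x) ->
  continuous (fun t => (x - t) ^ j / INR (fact j) * antiderivative g i t) t.
Proof.
  intros Hg. apply (continuous_mult (K := R_AbsRing)).
  - apply (ex_derive_continuous (V := R_NormedModule)). auto_derive. trivial.
  - apply antiderivative_continuous, Hg.
Qed.

(** Both boundary terms vanish: the kernel at [t = x], since its exponent is positive, and the
    antiderivative at [t = 0]. *)
Lemma RInt_by_parts_kernel (g : R -> R) (j i : nat) (x : R) :
  (forall x, continuous g x) ->
  RInt (fun t => (x - t) ^ S j / INR (fact (S j)) * antiderivative g i t) 0 x
    = RInt (fun t => (x - t) ^ j / INR (fact j) * antiderivative g (S i) t) 0 x.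
Proof.
  intros Hg.
  set (u := fun t => (x - t) ^ S j / INR (fact (S j)) * antiderivative g i t).
  set (v := fun t => (x - t) ^ j / INR (fact j) * antiderivative g (S i) t).
  assert (H : is_RInt (fun t => minus (u t) (v t)) 0 x
    (minus ((x - x) ^ S j / INR (fact (S j)) * antiderivative g (S i) x)
      ((x - 0) ^ S j / INR (fact (S j)) * antiderivative g (S i) 0))).
  { apply (is_RInt_derive (V := R_CompleteNormedModule)
      (fun t => (x - t) ^ S j / INR (fact (S j)) * antiderivative g (S i) t)).
    - intros t _.
      assert (Hp : is_derive (fun t => (x - t) ^ S j / INR (fact (S j))) t
        (- ((x - t) ^ j / INR (fact j)))).
      { assert (EK : INR (fact (S j)) = INR (S j) * INR (fact j))
          by (rewrite fact_simpl, mult_INR; reflexivity).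
        assert (HS : INR (S j) <> 0) by (apply not_0_INR; lia).
        rewrite EK. generalize (INR (fact j)) (INR_fact_neq_0 j). intros K HK.
        auto_derive; [trivial |]. simpl pred. fold_INR. unfold Rminus. field. split; assumption. }
      assert (Hm := is_derive_mult _ _ _ _ _ Hp (is_derive_antiderivative g i t Hg) Rmult_comm).
      match type of Hm with is_derive _ _ ?l => match goal with |- is_derive _ _ ?r =>
        replace r with l; [exact Hm |] end end.
      unfold u, v, minus, plus, opp, mult. simpl. unfold mult. simpl. real_eq. ring.
    - intros t _. apply (continuous_minus (V := R_NormedModule)); apply continuous_kernel, Hg. }
  assert (Hex : forall j i, ex_RInt (fun t => (x - t) ^ j / INR (fact j) * antiderivative g i t) 0 x).
  { intros j' i'. apply (ex_RInt_continuous (V := R_CompleteNormedModule)).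
    intros t _. apply continuous_kernel, Hg. }
  assert (E := eq_trans (eq_sym (RInt_minus (V := R_CompleteNormedModule) u v 0 x
    (Hex (S j) i) (Hex j (S i)))) (is_RInt_unique _ _ _ _ H)).
  replace (antiderivative g (S i) 0) with 0 in E by (symmetry; exact (RInt_point (V := R_CompleteNormedModule) 0 _)).
  replace (x - x) with 0 in E by ring. rewrite pow_ne_zero in E by lia.
  apply Rminus_diag_uniq. etransitivity; [exact E |].
  unfold minus, plus, opp. simpl. real_eq. unfold Rdiv. ring.
Qed.

(** Cauchy's formula for repeated integration: each integration by parts trades one power of the
    kernel for one more antiderivative, hence the general [i] in the induction on [j]. *)
Lemma RInt_kernel_antiderivative (g : R -> R) (j i : nat) (x : R) :
  (forall x, continuous g x) ->
  RInt (fun t => (x - t) ^ j / INR (fact j) * antiderivative g i t) 0 x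
    = antiderivative g (S (j + i)) x.
Proof.
  intros Hg. revert i. induction j as [| j IH]; intros i.
  - apply RInt_ext. intros t _. change ((x - t) ^ 0 / INR (fact 0) * antiderivative g i t = antiderivative g i t).
    simpl. field.
  - rewrite RInt_by_parts_kernel by exact Hg. rewrite IH.
    rewrite <- plus_n_Sm. reflexivity.
Qed.

Lemma I_op_antiderivative (c : R) (k : nat) (f : R -> R) (x : R) :
  continuous_on (Ic c) f -> (1 <= k)%nat -> Ic c x ->
  I_op k f x = antiderivative (fun t => f (clamp c t)) k x.
Proof.
  intros Hf Hk Hx. destruct k as [| k]; [lia |]. unfold I_op.
  replace (S k - 1)%nat with k by lia.
  replace (antiderivative _ (S k)) with (antiderivative (fun t => f (clamp c t)) (S (k + 0)))
    by (rewrite Nat.add_0_r; reflexivity).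
  rewrite <- RInt_kernel_antiderivative by (apply continuous_clamp, Hf).
  apply RInt_ext. intros t Ht. simpl. destruct Hx as [Hx0 Hx1].
  rewrite Rmin_left, Rmax_right in Ht by lra.
  rewrite clamp_id; [reflexivity |]. split; [lra |]. intros Hc. specialize (Hx1 Hc). lra.
Qed.

(** * Taylor bounds and comparison of coefficients *)

(** The mean value theorem is used twice. The increment from [mu] to [t] of [f] minus its linear
    part plus the quadratic correction is a derivative at [xi] times [t - mu]; that derivative
    equals (f''(eta) + M)(xi - mu), and [xi - mu] has the sign of [t - mu]. *)
Lemma taylor_lower_bound (c : R) (f df ddf : R -> R) (M mu t : R) :
  (forall x, Ic c x -> D_in f (fun _ => df x) (Ic c) x) ->
  (forall x, Ic c x -> D_in df (fun _ => ddf x) (Ic c) x) ->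
  (forall x, Ic c x -> - M <= ddf x) -> Ic c mu -> Ic c t ->
  f mu + df mu * (t - mu) - M / 2 * (t - mu) ^ 2 <= f t.
Proof.
  intros Hf Hdf HM Hmu Ht.
  destruct (Ic_MVT c (fun x => f x + (M / 2 * (x - mu) ^ 2 - df mu * (x - mu)))
    (fun x => df x + (M * (x - mu) - df mu)) mu t) as [xi [Hxi E]]; try assumption.
  { intros x Hx. apply Dadd; [apply Hf, Hx |]. apply is_derive_D_in.
    auto_derive; [trivial |]. field. }
  assert (Hxi' : Ic c xi).
  { unfold Rmin, Rmax in Hxi. destruct (Rle_dec mu t);
      [apply (Ic_between c mu t) | apply (Ic_between c t mu)]; assumption. }
  destruct (Ic_MVT c df ddf mu xi) as [eta [Heta E']]; try assumption.
  assert (Heta' : Ic c eta).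
  { unfold Rmin, Rmax in Heta. destruct (Rle_dec mu xi);
      [apply (Ic_between c mu xi) | apply (Ic_between c xi mu)]; assumption. }
  specialize (HM eta Heta').
  assert (Hs : 0 <= (xi - mu) * (t - mu)).
  { unfold Rmin, Rmax in Hxi. destruct (Rle_dec mu t); nra. }
  assert (0 <= (df xi + (M * (xi - mu) - df mu)) * (t - mu)).
  { replace (df xi) with (df mu + ddf eta * (xi - mu)) by lra.
    replace ((df mu + ddf eta * (xi - mu) + (M * (xi - mu) - df mu)) * (t - mu))
      with ((ddf eta + M) * ((xi - mu) * (t - mu))) by ring.
    apply Rmult_le_pos; lra. }
  nra.
Qed.

Lemma taylor_bound (c : R) (f df ddf : R -> R) (M mu t : R) :
  (forall x, Ic c x -> D_in f (fun _ => df x) (Ic c) x) ->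
  (forall x, Ic c x -> D_in df (fun _ => ddf x) (Ic c) x) ->
  (forall x, Ic c x -> Rabs (ddf x) <= M) -> Ic c mu -> Ic c t ->
  Rabs (f t - f mu - df mu * (t - mu)) <= M / 2 * (t - mu) ^ 2.
Proof.
  intros Hf Hdf HM Hmu Ht.
  assert (HM' : forall x, Ic c x -> - M <= ddf x <= M) by (intros; apply Rabs_le_between, HM; assumption).
  apply Rabs_le. split.
  - pose proof (taylor_lower_bound c f df ddf M mu t Hf Hdf (fun x Hx => proj1 (HM' x Hx)) Hmu Ht).
    lra.
  - assert (H := taylor_lower_bound c (fun x => - f x) (fun x => - df x) (fun x => - ddf x) M mu t
      (fun x Hx => Dopp _ _ _ _ (Hf x Hx)) (fun x Hx => Dopp _ _ _ _ (Hdf x Hx))).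
    cbv beta in H. assert (H' := H ltac:(intros x Hx; specialize (HM' x Hx); lra) Hmu Ht).
    lra.
Qed.

(** Apply [fdiff_antiderivative_ge] with step 1/n to [g] and to [- g]. As [mu] is the midpoint of
    the interval, the offset [d] is 0 and the slope [be] drops out. The constants [e] and [ga] allow
    one statement to serve both the Taylor bound and the modulus of continuity. *)
Lemma fdiff_antiderivative_approx (n : R) (k : nat) (g : R -> R) (j : nat) (be ga e : R) :
  0 < n -> (forall x, continuous g x) ->
  let mu := (2 * INR j + INR k) / (2 * n) in
  (forall t, INR j / n <= t <= (INR j + INR k) / n ->
    Rabs (g t - g mu - be * (t - mu)) <= e + ga * (t - mu) ^ 2) ->
  Rabs (n ^ k * fdiff k (fun i => antiderivative g k (INR i / n)) j - g mu)
    <= e + ga * INR k / (12 * n ^ 2).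
Proof.
  intros Hn Hg mu H. pose proof (Rinv_0_lt_compat n Hn) as Hh.
  assert (Hnk : 0 < n ^ k) by (apply pow_lt, Hn).
  assert (Hmu : (INR j + INR k / 2) * / n - mu = 0) by (unfold mu; field; lra).
  assert (H1 := fdiff_antiderivative_ge (/ n) k (antiderivative g) (g mu - e) be (- ga) mu j Hh
    (fun l t => is_derive_antiderivative g l t Hg)).
  assert (H2 := fdiff_antiderivative_ge (/ n) k (fun l t => - antiderivative g l t)
    (- g mu - e) (- be) (- ga) mu j Hh
    (fun l t => is_derive_opp (V := R_NormedModule) _ _ _ (is_derive_antiderivative g l t Hg))).
  cbv zeta in H1, H2. rewrite Hmu in H1, H2. rewrite fdiff_opp in H2.
  set (D := fdiff k (fun i => antiderivative g k (INR i / n)) j).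
  change (fdiff k (fun i => antiderivative g k (INR i * / n)) j) with D in H1, H2.
  assert (L1 := H1 ltac:(intros t Ht; specialize (H t Ht); apply Rabs_le_between in H;
    simpl antiderivative; lra)).
  assert (L2 := H2 ltac:(intros t Ht; specialize (H t Ht); apply Rabs_le_between in H;
    simpl antiderivative; lra)).
  assert (Hscale : forall y z, (/ n) ^ k * y <= z -> y <= n ^ k * z).
  { intros y z Hyz. apply (Rmult_le_compat_l (n ^ k)) in Hyz; [| lra].
    rewrite pow_inv in Hyz. rewrite <- Rmult_assoc, Rinv_r, Rmult_1_l in Hyz by lra. exact Hyz. }
  apply Hscale in L1. apply Hscale in L2.
  replace (ga * INR k / (12 * n ^ 2)) with (ga * INR k * (/ n) ^ 2 / 12) by (field; lra).
  apply Rabs_le. lra.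
Qed.

(** * Nodes, parameters and passage to the operators *)

(** For [c < 0] and n + kc = -cM, an index j <= M satisfies j + k <= -n/c, so the right end of its
    interval is at most -1/c; for j > M the basis function is zero. *)
Lemma node_in_Ic (c n : R) (k j : nat) (x : R) :
  0 < n -> (c < 0 -> exists M, n + INR k * c = - c * INR M) -> Ic c x ->
  basis c (n + INR k * c) j x = 0 \/ Ic c ((INR j + INR k) / n).
Proof.
  intros Hn Hneg Hx.
  assert (H0 : 0 <= (INR j + INR k) / n).
  { pose proof (pos_INR j). pose proof (pos_INR k). apply Rdiv_le_0_compat; lra. }
  destruct (Rlt_dec c 0) as [Hc | Hc]; [| right; split; [exact H0 | lra]].
  destruct (Hneg Hc) as [M HM]. destruct (Nat.lt_ge_cases M j) as [Hj | Hj].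
  - left. rewrite HM, basis_neg, bernstein_term_eq0 by assumption. reflexivity.
  - right. split; [exact H0 |]. intros _. apply le_INR in Hj.
    apply Rmult_le_reg_r with (- c * n); [apply Rmult_lt_0_compat; lra |].
    replace ((INR j + INR k) / n * (- c * n)) with (- c * INR j - INR k * c) by (field; lra).
    replace (- (1 / c) * (- c * n)) with n by (field; lra).
    assert (- c * INR j <= - c * INR M) by (apply Rmult_le_compat_l; lra). lra.
Qed.

Lemma parameter_pos (c n : R) :
  (0 <= c -> c < n) -> (c < 0 -> exists N, (1 <= N)%nat /\ - (n / c) = INR N) -> 0 < n.
Proof.
  intros Hpos Hneg. destruct (Rlt_dec c 0) as [Hc | Hc]; [| lra].
  destruct (Hneg Hc) as [N [HN E]]. apply le_INR in HN. simpl in HN.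
  replace n with (- c * - (n / c)) by (field; lra). rewrite E.
  apply Rmult_lt_0_compat; lra.
Qed.

(** For [c < 0] put N = -n/c; then n + ic = -c(N-i), and i <= k < N leaves N - i >= 1, the successor
    form that [basis_series_derive] takes. *)
Lemma parameter_shift (c n : R) (k i : nat) :
  (0 <= c -> c < n) -> (c < 0 -> exists N, (1 <= N)%nat /\ - (n / c) = INR N) ->
  (c < 0 -> INR k < - (n / c)) -> (i <= k)%nat ->
  (0 <= c -> 0 < n + INR i * c) /\
  (c < 0 -> exists M, n + INR i * c = - c * INR (S M)).
Proof.
  intros Hpos Hneg Hk Hi. split.
  - intros Hc. specialize (Hpos Hc). pose proof (Rmult_le_pos (INR i) c (pos_INR i) Hc). lra.
  - intros Hc. destruct (Hneg Hc) as [N [_ HN]]. specialize (Hk Hc). rewrite HN in Hk.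
    apply INR_lt in Hk. exists (N - i - 1)%nat.
    replace (S (N - i - 1)) with (N - i)%nat by lia.
    rewrite minus_INR, <- HN by lia. field. lra.
Qed.

(** Common to both claims: a uniform bound on the coefficient errors passes to the operators. It is
    asked only for those [j] whose right end lies in [Ic c], the other basis functions being
    zero. *)
Lemma V_minus_D_bound (c n : R) (k : nat) (f : R -> R) (E : R)
  (Hpos : 0 <= c -> c < n)
  (Hneg : c < 0 -> exists N : nat, (1 <= N)%nat /\ - (n / c) = INR N)
  (Hk : (1 <= k)%nat)
  (Hkneg : c < 0 -> INR k < - (n / c))
  (Hcont : continuous_on (Ic c) f)
  (HV : V_domain c n k f)
  (HD : D_domain c n k f)
  (HE : forall j, Ic c ((INR j + INR k) / n) ->
    Rabs (n ^ k * fdiff k (fun i => antiderivative (fun t => f (clamp c t)) k (INR i / n)) j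
      - f ((2 * INR j + INR k) / (2 * n))) <= E) :
  forall x, Ic c x -> Rabs (V_op c n k f x - D_op c n k f x) <= E.
Proof.
  intros x Hx.
  set (a := fun i => antiderivative (fun t => f (clamp c t)) k (INR i / n)) in *.
  pose proof (fun i Hi => parameter_shift c n k i Hpos Hneg Hkneg Hi) as Hshift.
  assert (Hn := parameter_pos c n Hpos Hneg).
  assert (Hweak : forall i, (i <= k)%nat -> c < 0 -> exists M, n + INR i * c = - c * INR M).
  { intros i Hi Hc. destruct (proj2 (Hshift i Hi) Hc) as [M HM]. exists (S M). exact HM. }
  assert (Hterm : forall y, Ic c y -> forall j,
    B_term c n (I_op k f) y j = a j * basis c n j y).
  { intros y Hy j. unfold B_term.
    (* With [k = 0] this concerns the nodes j/n. Where such a node may leave [Ic c], and [I_op] need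
       not agree with the clamped antiderivative, the basis function is zero. *)
    destruct (node_in_Ic c n 0 j y Hn (Hweak 0%nat (Nat.le_0_l k)) Hy) as [E0 | Hj];
      simpl (INR 0) in *.
    - replace (n + 0 * c) with n in E0 by ring. rewrite E0. ring.
    - rewrite Rplus_0_r in Hj. rewrite (I_op_antiderivative c) by assumption.
      unfold a. ring. }
  destruct (derive_n_basis_series c n k a (B_op c n (I_op k f))
    (fun i Hi => proj1 (Hshift i (Nat.lt_le_incl _ _ Hi)))
    (fun i Hi => proj2 (Hshift i (Nat.lt_le_incl _ _ Hi)))) with (x := x) as [Hex HB].
  { intros y Hy. apply ex_series_ext with (2 := HV y Hy). intros j.
    rewrite Hterm by exact Hy. reflexivity. }
  { intros y Hy. apply Series_ext, Hterm, Hy. }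
  { exact Hx. }
  set (m := n + INR k * c) in *.
  assert (Hr : 0 < rising c n k).
  { clear - Hshift Hn Hpos Hneg Hkneg.
    assert (H : forall i, (i <= k)%nat -> 0 < rising c n i); [| apply H, le_n].
    induction i as [| i IH]; intros Hi; simpl; [lra |].
    apply Rmult_lt_0_compat; [apply IH; lia |].
    destruct (Hshift i ltac:(lia)) as [H1 H2].
    destruct (Rlt_dec c 0) as [Hc | Hc]; [| specialize (H1 ltac:(lra)); lra].
    destruct (H2 Hc) as [M HM].
    assert (0 < - c * INR (S M)) by (apply Rmult_lt_0_compat; [lra | apply lt_0_INR; lia]). lra. }
  (* The product produced by the [k] differentiations cancels against the normalisation in
     [V_op]. *)
  assert (EV : V_op c n k f x = Series (fun j => n ^ k * (fdiff k a j * basis c m j x))).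
  { unfold V_op, Bk_op. rewrite HB, Series_scal_l. field. lra. }
  unfold D_op. rewrite EV, <- Series_minus;
    [| apply ex_series_Rmult, ex_series_Rabs, Hex | apply ex_series_Rabs, HD, Hx].
  assert (Hp1 : ex_series (fun j => basis c m j x)).
  { apply ex_series_ext with (fun j => Rabs (1 * basis c m j x)).
    - intros j. real_eq. rewrite Rmult_1_l. apply Rabs_pos_eq, basis_ge0; [| | exact Hx].
      + apply (Hshift k (le_n k)).
      + apply Hweak, le_n.
    - apply ex_series_basis; [apply (Hshift k (le_n k)) | apply Hweak, le_n | exact Hx]. }
  assert (HEp : ex_series (fun j => E * basis c m j x)) by (apply ex_series_Rmult, Hp1).
  assert (Hle : forall j, 0 <= Rabs (n ^ k * (fdiff k a j * basis c m j x) - D_term c n k f x j)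
    <= E * basis c m j x).
  { intros j. split; [apply Rabs_pos |]. unfold D_term. fold m.
    destruct (node_in_Ic c n k j x Hn (Hweak k (le_n k)) Hx) as [E0 | Hj].
    - fold m in E0. rewrite E0, !Rmult_0_r, Rminus_0_r, Rabs_R0. lra.
    - replace (n ^ k * (fdiff k a j * basis c m j x) - _) with
        ((n ^ k * fdiff k a j - f ((2 * INR j + INR k) / (2 * n))) * basis c m j x) by ring.
      assert (Hb : 0 <= basis c m j x).
      { apply basis_ge0; [apply (Hshift k (le_n k)) | apply Hweak, le_n | exact Hx]. }
      rewrite Rabs_mult, (Rabs_pos_eq (basis c m j x)) by exact Hb.
      apply Rmult_le_compat_r; [exact Hb | apply HE, Hj]. }
  eapply Rle_trans; [apply Series_Rabs | eapply Rle_trans; [apply Series_le; [exact Hle | exact HEp] |]].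
  - apply (ex_series_le (V := R_CompleteNormedModule)) with (2 := HEp). intros j.
    unfold norm; simpl; unfold abs; simpl. rewrite Rabs_Rabsolu. apply Hle.
  - rewrite Series_scal_l, basis_partition_of_unity; [lra | | | exact Hx];
      apply (Hshift k (le_n k)).
Qed.

Theorem theorem2 (c n : R) (k : nat)
  (Hpos : 0 <= c -> c < n)
  (Hneg : c < 0 -> exists N : nat, (1 <= N)%nat /\ - (n / c) = INR N)
  (Hk : (1 <= k)%nat)
  (Hkneg : c < 0 -> INR k < - (n / c))
  (f : R -> R)
  (Hcont : continuous_on (Ic c) f)
  (HV : V_domain c n k f)
  (HD : D_domain c n k f) :
  (Cn_on (Ic c) 2 f ->
   Rbar_lt (supnorm (Ic c) (derive_n_on (Ic c) 2 f)) p_infty ->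
   Rbar_le (supnorm (Ic c) (fun x => V_op c n k f x - D_op c n k f x))
     (Rbar_mult (Finite (INR k / (24 * n ^ 2)))
        (supnorm (Ic c) (derive_n_on (Ic c) 2 f))))
  /\
  Rbar_le (supnorm (Ic c) (fun x => V_op c n k f x - D_op c n k f x))
    (omega (Ic c) f (INR k / (2 * n))).
Proof.
  assert (Hn := parameter_pos c n Hpos Hneg).
  assert (H0 : Ic c 0).
  { split; [lra |]. intros Hc. apply Rlt_le, Ic_right_end, Hc. }
  assert (Hg := continuous_clamp c f Hcont).
  assert (Hnode : forall j t, Ic c ((INR j + INR k) / n) ->
    INR j / n <= t <= (INR j + INR k) / n -> Ic c t).
  { intros j t Hj Ht. apply (Ic_between c 0 ((INR j + INR k) / n)); try assumption.
    assert (0 <= INR j / n) by (apply Rdiv_le_0_compat; [apply pos_INR | exact Hn]). lra. }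
  assert (Hmid : forall j, INR j / n <= (2 * INR j + INR k) / (2 * n) <= (INR j + INR k) / n).
  { intros j. assert (0 <= INR k / n) by (apply Rdiv_le_0_compat; [apply pos_INR | exact Hn]).
    replace ((2 * INR j + INR k) / (2 * n)) with (INR j / n + INR k / n / 2) by (field; lra).
    replace ((INR j + INR k) / n) with (INR j / n + INR k / n) by (field; lra). lra. }
  assert (Hsup : forall E, (forall j, Ic c ((INR j + INR k) / n) ->
      Rabs (n ^ k * fdiff k (fun i => antiderivative (fun t => f (clamp c t)) k (INR i / n)) j
        - f ((2 * INR j + INR k) / (2 * n))) <= E) ->
    Rbar_le (supnorm (Ic c) (fun x => V_op c n k f x - D_op c n k f x)) (Finite E)).
  { intros E HE. apply Lub_Rbar_correct. intros y [x [Hx ->]].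
    apply (V_minus_D_bound c n k f E); assumption. }
  split.
  - intros [Hex _] Hfin.
    assert (HM : forall x, Ic c x -> Rbar_le (Rabs (derive_n_on (Ic c) 2 f x))
      (supnorm (Ic c) (derive_n_on (Ic c) 2 f))).
    { intros x Hx. apply Lub_Rbar_correct. exists x. split; [exact Hx | reflexivity]. }
    (* The value [m_infty] is impossible because the supremum dominates the value at 0. *)
    destruct (supnorm (Ic c) (derive_n_on (Ic c) 2 f)) as [M | |];
      [| contradiction | destruct (HM 0 H0)].
    apply Hsup. intros j Hj.
    assert (Hmu := Hnode j _ Hj (Hmid j)).
    set (mu := (2 * INR j + INR k) / (2 * n)) in *.
    (* The Taylor remainder gives [e = 0] and [ga = M / 2]; the slope is the derivative of [f] at
       [mu]. *)
    replace (INR k / (24 * n ^ 2) * M) with (0 + M / 2 * INR k / (12 * n ^ 2)) by (field; lra).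
    replace (f mu) with (f (clamp c mu)) by (rewrite clamp_id by exact Hmu; reflexivity).
    apply (fdiff_antiderivative_approx n k (fun t => f (clamp c t)) j
      (derive_n_on (Ic c) 1 f mu)); [exact Hn | exact Hg |].
    intros t Ht. fold mu. assert (Ht' := Hnode j t Hj Ht).
    rewrite !clamp_id, Rplus_0_l by assumption.
    apply (taylor_bound c f (derive_n_on (Ic c) 1 f) (derive_n_on (Ic c) 2 f)); try assumption.
    + intros x Hx. apply derive_on_correct, (Hex 0%nat); [exact Hx | lia | exact Hx].
    + intros x Hx. apply derive_on_correct, (Hex 1%nat); [exact Hx | lia | exact Hx].
  - assert (HM : forall s t, Ic c s -> Ic c t -> Rabs (s - t) <= INR k / (2 * n) ->
      Rbar_le (Rabs (f s - f t)) (omega (Ic c) f (INR k / (2 * n)))).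
    { intros s t Hs Ht Hst. apply Lub_Rbar_correct. exists s, t.
      split; [exact Hs | split; [exact Ht | split; [exact Hst | reflexivity]]]. }
    destruct (omega (Ic c) f (INR k / (2 * n))) as [E | |].
    + apply Hsup. intros j Hj.
      assert (Hmu := Hnode j _ Hj (Hmid j)). specialize (Hmid j).
      set (mu := (2 * INR j + INR k) / (2 * n)) in *.
      (* Here the slope and [ga] are 0 and [e = E]: every point of the interval is within its
         half-length k/(2n) of [mu]. *)
      replace E with (E + 0 * INR k / (12 * n ^ 2)) by (field; lra).
      replace (f mu) with (f (clamp c mu)) by (rewrite clamp_id by exact Hmu; reflexivity).
      apply (fdiff_antiderivative_approx n k (fun t => f (clamp c t)) j 0);
        [exact Hn | exact Hg |].
      intros t Ht. fold mu. assert (Ht' := Hnode j t Hj Ht).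
      rewrite !clamp_id by assumption.
      replace (f t - f mu - 0 * (t - mu)) with (f t - f mu) by ring.
      replace (E + 0 * (t - mu) ^ 2) with E by ring.
      apply (HM t mu Ht' Hmu). apply Rabs_le.
      replace (INR j / n) with (mu - INR k / (2 * n)) in Ht by (unfold mu; field; lra).
      replace ((INR j + INR k) / n) with (mu + INR k / (2 * n)) in Ht by (unfold mu; field; lra).
      lra.
    + apply (Rbar_le_trans _ p_infty); [| apply Rbar_le_refl].
      destruct (supnorm _ _); exact I.
    (* The pair s = t = 0 excludes [m_infty]. *)
    + destruct (HM 0 0 H0 H0).
      rewrite Rminus_0_r, Rabs_R0. apply Rdiv_le_0_compat; [apply pos_INR | lra].
Qed.
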